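(* Let $A$ be a regular system of divisors, and let $g,g_A:\mathbb N\to\mathbb C$ satisfy \[ \sum_{d\mid n}g(d)=\sum_{d\in A(n)}g_A(d)\quad\text{for every } n\in\mathbb N. \] Then for every $n\in\mathbb N$, \[ g_A(n)=\sum_{\substack{d\mid n\\ \gamma_A(n)\mid d}}g(d). \]
   Context: A regular system of divisors is a family $A=(A(n))_{n\in\mathbb N}$, where each $A(n)$ is a set of positive divisors of $n$, such that: (i) $A(1)=\{1\}$ and $A(mn)=\{de: d\in A(m), e\in A(n)\}$ whenever $\gcd(m,n)=1$; (ii) for every prime power $p^a$ ($a\ge1$) there is a divisor $t=t_A(p^a)$ of $a$ (the type of $p^a$) such that $A(p^{it})=\{1,p^t,\dots,p^{it}\}$ for every $0\le i\le a/t$. The $A$-core is $\gamma_A(n)=\prod_{p^a\parallel n}p^{a-t_A(p^a)+1}$, the product over the prime powers exactly dividing $n$. *)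

(* Defs.v *)
From mathcomp Require Import all_boot finmap.

Set Implicit Arguments.
Unset Strict Implicit.
Unset Printing Implicit Defensive.

Local Open Scope nat_scope.
Local Open Scope fset_scope.

(* A family of sets of divisors is a function A : nat -> {fset nat}; its value
   at 0 is irrelevant, since every condition below is restricted to positive
   arguments. *)

Definition is_type (A : nat -> {fset nat}) (p a t : nat) : bool :=
  (t %| a) &&
  [forall i : 'I_(a %/ t).+1,
     A (p ^ (i * t)) == [fset p ^ (j * t) | j in iota 0 i.+1]].

Record regular_system (A : nat -> {fset nat}) : Prop := RegularSystem {
  regular_dvd : forall n d, 0 < n -> d \in A n -> d %| n;
  regular_one : A 1 = [fset 1];
  regular_mul : forall m n, 0 < m -> 0 < n -> coprime m n ->
    A (m * n) = [fset d * e | d in A m, e in A n];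
  regular_pp : forall p a, prime p -> 0 < a -> exists t, is_type A p a t
}.

(* The type t_A(p^a).  By is_type_uniq below at most one t satisfies is_type,
   so taking the first one found involves no choice; the default value 0 is
   never used for a regular system (see type_ofP). *)
Definition type_of (A : nat -> {fset nat}) (p a : nat) : nat :=
  head 0 [seq t <- divisors a | is_type A p a t].

Definition core (A : nat -> {fset nat}) (n : nat) : nat :=
  \prod_(p <- primes n) p ^ (logn p n - type_of A p (logn p n) + 1).

Lemma is_type_mem (A : nat -> {fset nat}) p a t s :
  prime p -> 0 < a -> is_type A p a t -> 0 < s ->
  p ^ s \in A (p ^ a) -> t <= s.
Proof.
move=> pp a0 /andP[ta /forallP /(_ ord_max) /= /eqP].
rewrite divnK // => -> s0 /imfsetP[/= j _ /eqP].
rewrite eqn_exp2l ?prime_gt1 // => /eqP es; move: s0; rewrite es.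
case: j {es} => [|j]; first by rewrite mul0n.
by move=> _; apply: leq_pmull.
Qed.

Lemma is_type_self (A : nat -> {fset nat}) p a t :
  0 < a -> is_type A p a t -> (0 < t) && (p ^ t \in A (p ^ a)).
Proof.
move=> a0 /andP[ta /forallP /(_ ord_max) /= /eqP].
have t0 : 0 < t by rewrite (dvdn_gt0 a0 ta).
rewrite divnK // => ->; rewrite t0; apply/imfsetP; exists 1; rewrite ?mul1n //=.
by rewrite in_cons mem_iota add1n /= ltnS divn_gt0 // dvdn_leq.
Qed.

Lemma is_type_uniq (A : nat -> {fset nat}) p a t t' :
  prime p -> 0 < a -> is_type A p a t -> is_type A p a t' -> t = t'.
Proof.
move=> pp a0 ht ht'; have /andP[t0 tA] := is_type_self a0 ht.
have /andP[t0' tA'] := is_type_self a0 ht'; apply/eqP.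
by rewrite eqn_leq (is_type_mem pp a0 ht t0' tA') (is_type_mem pp a0 ht' t0 tA).
Qed.

Lemma type_ofP (A : nat -> {fset nat}) p a :
  regular_system A -> prime p -> 0 < a -> is_type A p a (type_of A p a).
Proof.
move=> rA pp a0; have [t ht] := regular_pp rA pp a0.
have : t \in [seq t <- divisors a | is_type A p a t].
  by rewrite mem_filter ht -dvdn_divisors //; case/andP: ht.
rewrite /type_of; case E: [seq _ <- _ | _] => [//|u s] _ /=.
have : u \in [seq t <- divisors a | is_type A p a t] by rewrite E mem_head.
by rewrite mem_filter => /andP[].
Qed.

(* Main.v *)
Require Import Defs.
From mathcomp Require Import all_boot all_order all_algebra finmap reals complex.
From mathcomp Require Import zify.

Import GRing.Theory.

(** Write [h n] for the right-hand side. An element [m] of [A n] has at each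
    prime [p] with [p^a || n] an exponent that is a multiple of [t = t_A(p^a)],
    and the type of this smaller power is still [t]. Hence, for [d %| n], the
    conditions [d %| m] and [core A m %| d] say that the exponent of [m] at [p]
    is the exponent of [d] rounded up to a multiple of [t]: each [d %| n] is
    counted for exactly one [m] in [A n]. So [h] and [gA] have the same sums
    over every [A n], and they agree because [n] is the largest element of
    [A n]. *)

Local Open Scope nat_scope.

(** * Divisibility through prime exponents *)

Section PrimeExponents.
Implicit Types (m n p q d : nat) (f : nat -> nat).

Lemma dvdn_from_log m d : 0 < m -> 0 < d ->
  {in primes m, forall p, logn p m <= logn p d} -> m %| d.
Proof.
move=> m0 d0 le_md; apply/dvdn_partP => // p pm; rewrite p_part.
by rewrite pfactor_dvdn ?le_md //; move: pm; rewrite /= mem_primes => /andP[].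
Qed.

Lemma prod_pfactor_gt0 f (s : seq nat) :
  all prime s -> 0 < \prod_(p <- s) p ^ f p.
Proof.
move=> sp; rewrite big_seq; apply: prodn_cond_gt0 => p /(allP sp) pp.
by rewrite expn_gt0 prime_gt0.
Qed.

Lemma logn_prod_pfactor f q (s : seq nat) : uniq s -> all prime s ->
  logn q (\prod_(p <- s) p ^ f p) = if q \in s then f q else 0.
Proof.
elim: s => [|p s IHs] /=; first by rewrite big_nil logn1.
move=> /andP[ps us] /andP[pp sp]; rewrite big_cons lognM ?prod_pfactor_gt0 //.
  rewrite IHs // lognX (logn_prime _ pp) inE.
  by case: eqVneq => [->|_]; rewrite ?(negPf ps) ?muln1 ?addn0 ?muln0.
by rewrite expn_gt0 prime_gt0.
Qed.

Lemma all_prime_primes n : all prime (primes n).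
Proof. by apply/allP => p; rewrite mem_primes => /andP[]. Qed.

Lemma logn_prod_primes f n q :
  logn q (\prod_(p <- primes n) p ^ f p) = if q \in primes n then f q else 0.
Proof. exact: logn_prod_pfactor (primes_uniq n) (all_prime_primes n). Qed.

Lemma prod_primes_gt0 f n : 0 < \prod_(p <- primes n) p ^ f p.
Proof. exact: prod_pfactor_gt0 (all_prime_primes n). Qed.

Lemma prod_primes_dvdn f n d : 0 < d ->
  reflect {in primes n, forall p, f p <= logn p d}
          (\prod_(p <- primes n) p ^ f p %| d).
Proof.
move=> d0; apply: (iffP idP) => [dv p pn|le_fd].
  by have := dvdn_leq_log p d0 dv; rewrite logn_prod_primes pn.
apply: dvdn_from_log => // [|p _]; first exact: prod_primes_gt0.
by rewrite logn_prod_primes; case: ifP => // /le_fd.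
Qed.

(** Compare the exponents of [q] on both sides of the factorization of [m] into its [p]-part and its
    [p]-free part. *)
Lemma logn_partC p q m : prime p -> 0 < m ->
  logn q m`_p^' = (q != p) * logn q m.
Proof.
move=> pp m0; have := congr1 (logn q) (partnC p m0).
rewrite lognM ?part_gt0 // p_part lognX (logn_prime _ pp).
case: eqVneq => [->|_] /=; last by rewrite muln0 mul1n.
by rewrite muln1 mul0n => /eqP; rewrite -{2}[logn p m]addn0 eqn_add2l => /eqP.
Qed.

End PrimeExponents.

(** * Multiples of [t] in a half-open window of length [t] *)

Section RoundUp.
Implicit Types a b e t : nat.

Definition round_up t b := (b + t.-1) %/ t * t.

Lemma round_up_bounds t b : 0 < t -> b <= round_up t b < b + t.
Proof.
move=> t0; rewrite /round_up.
have := divn_eq (b + t.-1) t; have := ltn_pmod (b + t.-1) t0; lia.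
Qed.

Lemma multiple_in_window_uniq t b e e' : t %| e -> t %| e' ->
  b <= e < b + t -> b <= e' < b + t -> e = e'.
Proof.
move=> /dvdnP[i ->] /dvdnP[j ->] he he'; congr (_ * _); apply/eqP.
(* The window from [b] to [b + t] contains a point, so it has positive length. *)
have t0 : 0 < t by lia.
have hij : i * t < j.+1 * t by rewrite mulSn; lia.
have hji : j * t < i.+1 * t by rewrite mulSn; lia.
by move: hij hji; rewrite !ltn_pmul2r // !ltnS eqn_leq => -> ->.
Qed.

(** The rounded value is a multiple of [t] lying below [b + t <= a + t], and [a + t] is the first
    multiple of [t] after [a]. *)
Lemma round_up_le t a b : 0 < t -> t %| a -> b <= a -> round_up t b <= a.
Proof.
move=> t0 /dvdnP[i ->] ba; have := round_up_bounds t b t0 => hr.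
have : round_up t b < i.+1 * t by rewrite mulSn; lia.
by rewrite /round_up ltn_pmul2r // ltnS leq_pmul2r.
Qed.

End RoundUp.

(** * Membership in [A n] and divisibility by the core, prime by prime *)

Section RegularSystem.
Variable A : nat -> {fset nat}.
Hypothesis hA : regular_system A.
Implicit Types (m n p d : nat).

Lemma type_dvd p n : p \in primes n -> type_of A p (logn p n) %| logn p n.
Proof.
move=> pn; have pp : prime p by move: pn; rewrite mem_primes => /andP[].
by rewrite -logn_gt0 in pn; case/andP: (type_ofP hA pp pn).
Qed.

Lemma type_gt0 p n : p \in primes n -> 0 < type_of A p (logn p n).
Proof. by move=> pn; rewrite (dvdn_gt0 _ (type_dvd _ _ pn)) // logn_gt0. Qed.

Lemma mem_prime_power p a x : prime p -> 0 < a ->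
  reflect (exists2 j, j * type_of A p a <= a & x = p ^ (j * type_of A p a))
          (x \in A (p ^ a)).
Proof.
move=> pp a0; have ht := type_ofP hA pp a0.
have /andP[t0 _] := is_type_self a0 ht.
case/andP: ht => ta /forallP /(_ ord_max) /= /eqP; rewrite divnK // => ->.
have memj j : (j \in iota 0 (a %/ type_of A p a).+1) = (j * type_of A p a <= a).
  by rewrite mem_iota add0n ltnS leq_divRL.
apply: (iffP (imfsetP _ _ _ _)) => /= -[j hj ->]; exists j => //.
  by rewrite -memj.
by rewrite memj.
Qed.

(** Strong induction on [n]: [regular_mul] splits off the full power of one prime, and
    [mem_prime_power] describes that factor. For [p] outside [primes n], [m %| n] makes the exponent
    of [m] equal to [0], which every value of [type_of] divides. *)
Lemma mem_regular n m : 0 < n ->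
  m \in A n <-> m %| n /\ forall p, type_of A p (logn p n) %| logn p m.
Proof.
elim/ltn_ind: n m => n IH m n0.
have [->|n1] := eqVneq n 1.
  rewrite (regular_one hA) inE; split=> [/eqP ->|[]]; last by rewrite dvdn1.
  by split=> // p; rewrite logn1 dvdn0.
have [p pn] : exists p, p \in primes n.
  by exists (pdiv n); rewrite pi_pdiv; lia.
have [pp _ _] := and3P (etrans (esym (mem_primes _ _)) pn).
have a0 : 0 < logn p n by rewrite logn_gt0.
set n2 := n`_p^'; have n20 : 0 < n2 by rewrite part_gt0.
have En : p ^ logn p n * n2 = n by rewrite -p_part partnC.
have n2n : n2 < n.
  by rewrite -[ltnRHS]En ltn_Pmull // -(expn0 p) ltn_exp2l // prime_gt1.
have AE : A n = [fset d * e | d in A (p ^ logn p n), e in A n2]%fset.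
  rewrite -{1}En (regular_mul hA) ?pfactor_gt0 //.
  by rewrite -p_part coprime_partC.
split=> [mA|[mn mt]].
- split=> [|q]; first exact: (regular_dvd hA n0 mA).
  move: mA; rewrite AE => /imfset2P[/= x /(mem_prime_power _ _ _ pp a0)[j _ ->]].
  move=> [y /(IH _ n2n _ n20)[yn yt] ->].
  have y0 : 0 < y by exact: dvdn_gt0 yn.
  have p0 : 0 < p ^ (j * type_of A p (logn p n)) by rewrite expn_gt0 prime_gt0.
  rewrite lognM // lognX (logn_prime _ pp).
  have := dvdn_leq_log q n20 yn; have := yt q; rewrite logn_partC //.
  case: eqVneq => [->|_] /=; last by rewrite muln0 mul1n.
  rewrite mul0n leqn0 => _ /eqP ->.
  by rewrite muln1 addn0 dvdn_mull.
- have m0 : 0 < m by exact: dvdn_gt0 mn.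
  rewrite AE; apply/imfset2P => /=; exists (p ^ logn p m).
    apply/mem_prime_power => //; exists (logn p m %/ type_of A p (logn p n));
      by rewrite divnK // dvdn_leq_log.
  exists m`_p^'; last by rewrite -p_part partnC.
  apply/(IH _ n2n _ n20); split=> [|q]; first exact: partn_dvd.
  rewrite !logn_partC //; case: eqVneq => [->|_] /=; first by rewrite mul0n dvdn0.
  by rewrite !mul1n.
Qed.

Lemma regular_gt0 n m : 0 < n -> m \in A n -> 0 < m.
Proof. by move=> n0 /(regular_dvd hA n0); apply: dvdn_gt0. Qed.

Lemma mem_regular_self n : 0 < n -> n \in A n.
Proof.
move=> n0; apply/mem_regular => //; split=> // p.
have [/type_dvd //|] := boolP (p \in primes n).
by rewrite -logn_gt0 lt0n negbK => /eqP ->.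
Qed.

(** A type [t] of [p ^ a] prescribes [A (p ^ (i * t))] for all [i <= a %/ t]. If [t] divides a
    smaller exponent [e], the conditions for [p ^ e] are an initial segment of these, so [t] is a
    type of [p ^ e] too; types are unique. *)
Lemma type_of_mem n m p : 0 < n -> m \in A n -> p \in primes m ->
  type_of A p (logn p m) = type_of A p (logn p n).
Proof.
move=> n0 mA pm; have [mn mt] := (mem_regular n m n0).1 mA.
have [pp _ _] := and3P (etrans (esym (mem_primes _ _)) pm).
have e0 : 0 < logn p m by rewrite logn_gt0.
have le_ea := dvdn_leq_log p n0 mn.
have a0 : 0 < logn p n by exact: leq_trans le_ea.
have /andP[ta /forallP hi] := type_ofP hA pp a0.
apply: is_type_uniq pp e0 (type_ofP hA pp e0) _; apply/andP; split=> //.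
apply/forallP => -[i lti] /=.
have lti' : i < (logn p n %/ type_of A p (logn p n)).+1.
  by apply: leq_trans lti _; rewrite ltnS leq_div2r.
exact: hi (Ordinal lti').
Qed.

(** With [e] the exponent of [m] and [t] the type, [e - t + 1 <= logn p d] is rewritten as
    [e < logn p d + t]. In this form the condition extends from [primes m] to [primes n], because it
    holds when [e = 0]. *)
Lemma core_dvdn n m d : 0 < n -> m \in A n -> 0 < d ->
  reflect {in primes n, forall p,
             logn p m < logn p d + type_of A p (logn p n)}
          (core A m %| d).
Proof.
move=> n0 mA d0; have [mn mt] := (mem_regular n m n0).1 mA.
have m0 := regular_gt0 n m n0 mA.
apply: (iffP (prod_primes_dvdn _ m d d0)) => [le_d p pn|lt_d p pm].
  have t0 := type_gt0 p n pn.
  have [pm|] := boolP (p \in primes m).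
    by have := le_d p pm; rewrite (type_of_mem n) //; lia.
  by rewrite -logn_gt0; lia.
have pn : p \in primes n.
  move: pm; rewrite !mem_primes m0 n0 => /and3P[-> _ pm] /=.
  exact: dvdn_trans mn.
rewrite (type_of_mem n) //; have := lt_d p pn.
(* This makes the truncated subtraction in [core] exact. *)
have : type_of A p (logn p n) <= logn p m by rewrite dvdn_leq ?logn_gt0.
lia.
Qed.

Lemma core_window_ex n d : 0 < n -> d %| n ->
  exists2 m, m \in A n & (d %| m) && (core A m %| d).
Proof.
move=> n0 dn; have d0 : 0 < d by exact: dvdn_gt0 dn.
(* Rounding up stays within the exponent of [n], since that exponent is itself a multiple of the
   type. *)
pose f p := round_up (type_of A p (logn p n)) (logn p d).
pose m := \prod_(p <- primes n) p ^ f p.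
have m0 : 0 < m by exact: prod_primes_gt0.
have mE p : logn p m = if p \in primes n then f p else 0.
  exact: logn_prod_primes.
have mA : m \in A n.
  apply/mem_regular => //; split=> [|p]; last first.
    by rewrite mE; case: ifP; rewrite ?dvdn0 // dvdn_mull.
  apply/prod_primes_dvdn => // p pn.
  by rewrite round_up_le ?type_gt0 ?type_dvd // dvdn_leq_log.
exists m => //; apply/andP; split.
  apply: dvdn_from_log => // p pd.
  have pn : p \in primes n.
    by rewrite -logn_gt0 (leq_trans _ (dvdn_leq_log p n0 dn)) // logn_gt0.
  by rewrite mE pn; case/andP: (round_up_bounds _ (logn p d) (type_gt0 p n pn)).
apply/(core_dvdn n) => // p pn.
by rewrite mE pn; case/andP: (round_up_bounds _ (logn p d) (type_gt0 p n pn)).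
Qed.

(** At each prime of [n], both exponents are multiples of the type in the same window starting at
    [logn p d]; at other primes both vanish. *)
Lemma core_window_uniq n d m m' : 0 < n -> d %| n ->
  m \in A n -> (d %| m) && (core A m %| d) ->
  m' \in A n -> (d %| m') && (core A m' %| d) -> m = m'.
Proof.
move=> n0 dn mA /andP[dm cm] mA' /andP[dm' cm'].
have d0 : 0 < d by exact: dvdn_gt0 dn.
have m0 := regular_gt0 n m n0 mA; have m0' := regular_gt0 n m' n0 mA'.
have [mn mt] := (mem_regular n m n0).1 mA.
have [mn' mt'] := (mem_regular n m' n0).1 mA'.
apply: eqn_from_log => // p.
have [pn|] := boolP (p \in primes n).
  apply: (@multiple_in_window_uniq (type_of A p (logn p n)) (logn p d)) => //.
    by rewrite dvdn_leq_log //=; move/(core_dvdn n _ _ n0 mA d0): cm; apply.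
  by rewrite dvdn_leq_log //=; move/(core_dvdn n _ _ n0 mA' d0): cm'; apply.
rewrite -logn_gt0 lt0n negbK => /eqP a0.
have := dvdn_leq_log p n0 mn; have := dvdn_leq_log p n0 mn'.
by rewrite a0 !leqn0 => /eqP -> /eqP ->.
Qed.

(** * Sums over [A n] *)

Local Open Scope ring_scope.

(** Gives the inner sums a range independent of [m], so that the two summations can be exchanged. *)
Lemma sum_divisors_dvd (V : nmodType) (F : nat -> V) (P : pred nat) m n :
  (0 < n)%N -> (m %| n)%N ->
  \sum_(d <- divisors m | P d) F d =
  \sum_(d <- divisors n | (d %| m)%N && P d) F d.
Proof.
move=> n0 mn; have m0 : (0 < m)%N by exact: dvdn_gt0 mn.
rewrite -big_filter_cond; apply: perm_big; apply: uniq_perm => [||d].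
- exact: divisors_uniq.
- by rewrite filter_uniq // divisors_uniq.
rewrite mem_filter -!dvdn_divisors //.
by case dm: (d %| m)%N => //=; rewrite (dvdn_trans dm mn).
Qed.

Lemma sum_regular_core (V : nmodType) (F : nat -> V) n : (0 < n)%N ->
  \sum_(m <- A n) \sum_(d <- divisors m | (core A m %| d)%N) F d =
  \sum_(d <- divisors n) F d.
Proof.
move=> n0.
transitivity (\sum_(m <- A n) \sum_(d <- divisors n)
                 if (d %| m)%N && (core A m %| d)%N then F d else 0).
  apply: eq_big_seq => m mA.
  by rewrite (sum_divisors_dvd _ _ _ m n) ?(regular_dvd hA n0) // big_mkcond.
rewrite exchange_big; apply: eq_big_seq => d; rewrite -dvdn_divisors // => dn.
have [m mA hm] := core_window_ex n d n0 dn.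
(* For fixed [d], only the one [m] whose window contains [d] contributes. *)
rewrite (bigD1_seq m) ?fset_uniq //= hm big_seq_cond big1 ?addr0 // => m'.
move=> /andP[mA' neq]; case: ifP => // hm'.
by rewrite (core_window_uniq n d m' m) ?eqxx in neq.
Qed.

(** The system is triangular: [n] lies in [A n] and all other elements are smaller, so strong
    induction cancels every term but the one at [n]. *)
Lemma eq_from_regular_sum (V : zmodType) (F G : nat -> V) :
  (forall n, (0 < n)%N -> \sum_(d <- A n) F d = \sum_(d <- A n) G d) ->
  forall n, (0 < n)%N -> F n = G n.
Proof.
move=> FG; elim/ltn_ind => n IH n0; have := FG n n0.
rewrite !(bigD1_seq n) ?fset_uniq ?mem_regular_self //=.
suff -> : \sum_(d <- A n | d != n) F d = \sum_(d <- A n | d != n) G d.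
  exact: addIr.
rewrite big_seq_cond [RHS]big_seq_cond; apply: eq_bigr => d /andP[dA dn].
apply: IH (regular_gt0 n d n0 dA).
by rewrite ltn_neqAle dn dvdn_leq // (regular_dvd hA n0).
Qed.

End RegularSystem.

Local Open Scope ring_scope.
Local Open Scope complex_scope.

Theorem theorem3 (R : realType) (A : nat -> {fset nat}) (g gA : nat -> R[i])
  (hA : regular_system A)
  (hg : forall n : nat, (0 < n)%N ->
    \sum_(d <- divisors n) g d = \sum_(d <- A n) gA d) :
  forall n : nat, (0 < n)%N ->
    gA n = \sum_(d <- divisors n | (core A n %| d)%N) g d.
Proof.
apply: (eq_from_regular_sum A hA) => n n0.
by rewrite sum_regular_core // hg.
Qed.
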